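(* Let $a,b$ be integers with $b>a>1$. Then Lebesgue almost every $x\in(0,1)$ has a continuum (i.e. $2^{\aleph_0}$ many) of $a,b$-expansions.
   Context: Fix integers $a,b$ with $b>a>1$. Let $\Sigma=\{0,\dots,b-1\}^{\mathbb{N}}$, with sequences indexed from $1$. For $d=(d_i)\in\Sigma$ and $n\in\mathbb{N}$ let $0_n(d)$ be the number of zeros among $d_1,\dots,d_n$. Define $\pi:\Sigma\to[0,1]$ by \[ \pi(d)=\sum_{i=1}^{\infty}d_i\left(\frac{1}{a}\right)^{0_i(d)}\left(\frac{1}{b}\right)^{i-0_i(d)}. \] A sequence $d\in\Sigma$ with $\pi(d)=x$ is called an $a,b$-expansion of $x$. *)

(* Defs.v *)
From mathcomp Require Import all_boot all_order all_algebra.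
From mathcomp Require Import all_classical all_reals all_analysis.

Set Implicit Arguments.
Unset Strict Implicit.
Unset Printing Implicit Defensive.

Import Order.TTheory GRing.Theory Num.Theory.
Import numFieldNormedType.Exports.

Local Open Scope classical_set_scope.
Local Open Scope ring_scope.

(* Sequences are indexed from 0 here: [d i] is the mathematical digit
   d_{i+1}, and [zeros d n] is 0_n(d), the number of zeros among d_1, ..., d_n. *)
Definition zeros (b : nat) (d : nat -> 'I_b) (n : nat) : nat :=
  (\sum_(i < n) (d i == 0 :> nat))%N.

Definition ab_term (R : realType) (a b : nat) (d : nat -> 'I_b) (i : nat) : R :=
  (d i)%:R * (a%:R^-1) ^+ zeros d i.+1 * (b%:R^-1) ^+ (i.+1 - zeros d i.+1).

(* For 1 < a < b the terms lie between 0 and b / a ^ (i + 1), so the series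
   converges and the limit is its sum. *)
Definition ab_value (R : realType) (a b : nat) (d : nat -> 'I_b) : R :=
  limn (series (ab_term R a d)).

Definition ab_expansions (R : realType) (a b : nat) (x : R) : set (nat -> 'I_b) :=
  [set d | ab_value R a d = x].

Arguments ab_expansions {R} a b x.

(* Main.v *)
Require Import Defs.
From mathcomp Require Import all_boot all_order all_algebra.
From mathcomp Require Import all_classical all_reals all_analysis.
From mathcomp Require Import ring lra.

(** Reading a digit [d] off [x] replaces [x] by [a * x] when [d] is [0] and by
    [b * x - d] otherwise, and a digit is legal when the new point is still in
    [[0, 1[].  The half-open unit interval is preserved by at least one digit at
    every point, and digit [0] competes with a positive digit exactly on the
    ambiguous interval [[1/b, 1/a[].  Any infinite sequence of legal choices
    is an expansion, because the remainder after [n] digits is at most [a^-n]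
    ([ab_value_orbit]).

    Call [x] univoque when its forced orbit never visits the ambiguous interval.
    If the univoque set [U] is null, so is the set of points from which some
    finite sequence of digits leads into [U], a countable union of affine
    preimages of [U].  Outside it, every way of making the choices meets the
    ambiguous interval again and again, so that an infinite sequence of bits can
    be used to make the successive free choices; distinct sequences of bits give
    distinct expansions ([branch_code_inj]).  Hence there are at least continuum
    many expansions, and at most continuum many digit sequences.

    That [U] is null ([univoque_null]) follows from comparing masses.  Write
    [p s t] for the measure of the part of [U] in [[s, t[], and
    [v = p 0 1], [w = p 0 (1/b)], [u = p (1/b) (2/b)].  The interval
    [[d/b, (d+1)/b[] of a positive digit [d] has mass at most [v/b], while
    scaling by [a] near [0] gives [a w = p 0 (a/b) <= w + u + (a-2) v/b].  With
    [v <= w + u + (b-2) v/b] this yields [v <= b u].  However, the ambiguous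
    interval removes the start of [[1/b, 2/b[], so [b u] is at most [p t0 1]
    for some [t0 > 0].  Therefore [p 0 t0 = 0], scaling by [a] spreads the zero
    mass to [[0, 1/b[] and then to [[0, a/b[], which contains [[1/b, 2/b[], so
    that [u = 0] and finally [v = 0]. *)

Import Order.TTheory GRing.Theory Num.Theory.
Import numFieldNormedType.Exports.

Local Open Scope classical_set_scope.
Local Open Scope card_scope.
Local Open Scope ring_scope.

Set Implicit Arguments.
Unset Strict Implicit.
Unset Printing Implicit Defensive.

(** * Legal digits and univoque points *)

Definition rate (a b d : nat) : nat := if d == 0%N then a else b.

Definition expand {R : realType} (a b d : nat) (x : R) : R :=
  (rate a b d)%:R * x - d%:R.

Definition ambiguous {R : realType} (a b : nat) : set R :=
  `[b%:R^-1, a%:R^-1[.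

Definition unambiguous {R : realType} (a b : nat) : set R :=
  `[0, 1[ `\` ambiguous a b.

(** Membership at stage [n] asks for one legal digit at each of the first [n]
    steps; away from the ambiguous interval that digit is unique, so this
    follows the forced orbit without naming it, and only affine preimages
    enter. *)
Fixpoint survivors {R : realType} (a b n : nat) : set R :=
  if n is n'.+1 then
    unambiguous a b `&`
      \bigcup_(d in `I_b) expand a b d @^-1` survivors a b n'
  else unambiguous a b.

Definition univoque {R : realType} (a b : nat) : set R :=
  \bigcap_n survivors a b n.

Lemma in01 {R : realType} (x : R) : (`[0, 1[%classic x) = (0 <= x < 1 :> bool).
Proof. by rewrite /= in_itv. Qed.

Lemma survivors_sub {R : realType} (a b n : nat) :
  @survivors R a b n `<=` unambiguous a b.
Proof. by case: n => [//|n] x []. Qed.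

(** Two positive digits have disjoint ranges of legality, and digit [0] is legal
    together with a positive one only on the ambiguous interval. *)
Lemma expand_digit_inj {R : realType} (a b d e : nat) (x : R) :
  (0 < a)%N -> (0 < b)%N -> unambiguous a b x ->
  0 <= expand a b d x < 1 -> 0 <= expand a b e x < 1 -> d = e.
Proof.
move=> a0 b0 [_ +].
rewrite /ambiguous /expand /rate /= in_itv /= => nS.
have a0' : 0 < a%:R :> R by rewrite ltr0n.
have b0' : 0 < b%:R :> R by rewrite ltr0n.
have mixed (k : nat) : (0 < k)%N -> 0 <= a%:R * x < 1 ->
    0 <= b%:R * x - k%:R < 1 -> False.
  move=> k0 /andP[_ xa] /andP[xb _]; apply: nS.
  rewrite -(ler_pM2l b0') -(ltr_pM2l a0') !mulfV ?gt_eqF // xa andbT.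
  by apply: (@le_trans _ _ k%:R); rewrite ?ler1n // -subr_ge0.
case: d => [|d]; case: e => [|e] //=; rewrite ?subr0.
- by move=> h1 /(mixed e.+1 isT h1).
- by move=> /[swap] h1 /(mixed d.+1 isT h1).
move=> /andP[d1 d2] /andP[e1 e2].
have close (m n : nat) : m%:R - n%:R < 1 :> R -> (m <= n)%N.
  by rewrite ltrBlDr nat1r ltr_nat ltnS.
by apply/eqP; rewrite eqn_leq !close //; lra.
Qed.

(** Each stage of [survivors] provides some legal digit, possibly depending on
    the stage; uniqueness of legal digits makes them all equal to [d]. *)
Lemma univoque_expand {R : realType} (a b d : nat) (x : R) :
  (0 < a)%N -> (0 < b)%N ->
  univoque a b x -> 0 <= expand a b d x < 1 -> univoque a b (expand a b d x).
Proof.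
move=> a0 b0 Ux dx n _.
have [xna [e /= eb ex]] := Ux n.+1 I.
have := ex => /survivors_sub[+ _]; rewrite in01 => e01.
by rewrite (expand_digit_inj a0 b0 xna dx e01).
Qed.

Lemma expand_univoque {R : realType} (a b d : nat) (x : R) :
  (d < b)%N -> unambiguous a b x -> univoque a b (expand a b d x) ->
  univoque a b x.
Proof.
by move=> db xna Ux [|n] _ //; split => //; exists d => //; exact: Ux.
Qed.

(** * Lebesgue measure and affine maps *)

Lemma measurable_affine {R : realType} (r c : R) :
  measurable_fun [set: measurableTypeR R]
    ((fun x => r * x + c) : measurableTypeR R -> measurableTypeR R).
Proof.
by apply: (@measurable_realfun.measurable_funD _ _ _ _ ( *%R r) (cst c)).
Qed.

Lemma measurable_affine_preimage {R : realType} (A : set R) (r c : R) :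
  measurable A -> measurable ((fun x => r * x + c) @^-1` A).
Proof.
by move=> mA; rewrite -[X in measurable X]setTI; exact: measurable_affine.
Qed.

Lemma measurable_unambiguous {R : realType} (a b : nat) :
  measurable (unambiguous a b : set R).
Proof. by apply: measurableD; exact: measurable_itv. Qed.

Lemma measurable_univoque {R : realType} (a b : nat) :
  measurable (univoque a b : set R).
Proof.
apply: bigcap_measurable => // n _.
elim: n => [|n IH] /=; first exact: measurable_unambiguous.
apply: measurableI; first exact: measurable_unambiguous.
apply: bigcup_measurable => d _.
exact: measurable_affine_preimage.
Qed.

(** [r] times the pushforward of Lebesgue measure along the map agrees with
    Lebesgue measure on the intervals []s, t]], hence everywhere. *)
Lemma lebesgue_measure_affine {R : realType} (r c : R) (A : set R) :
  0 < r -> measurable A ->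
  lebesgue_measure ((fun x => r * x + c) @^-1` A) =
  (r^-1%:E * lebesgue_measure A)%E.
Proof.
move=> r0 mA.
have r'0 : 0 <= r by exact: ltW.
pose m := mscale (NngNum r'0)
  (measure_function_pushforward__canonical__measure_function_Measure
     (@lebesgue_measure R)
     (measurable_affine r c)).
suff -> : lebesgue_measure A = m A.
  rewrite /m /mscale /= /pushforward muleA -EFinM mulVf ?gt_eqF //.
  by rewrite mul1e.
apply: lebesgue_measure_unique => //= _ [[s t]] _ <-.
rewrite /m /mscale /= /pushforward.
have -> : (fun x => r * x + c) @^-1` `]s, t] =
    `](s - c) / r, (t - c) / r]%classic.
  apply/seteqP; split => x /=; rewrite !in_itv /= ltr_pdivrMr // ler_pdivlMr //;
    by rewrite mulrC ltrBlDr lerBrDr.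
rewrite !lebesgue_measure_itv /= !lte_fin ltr_pM2r ?invr_gt0 // ltrD2r.
case: ifP => // _; last by rewrite mule0.
rewrite -!EFinB -EFinM; congr (_%:E).
by field; rewrite gt_eqF.
Qed.

(** Real-valued, so that the comparison of masses below is plain linear
    arithmetic. *)
Definition mass {R : realType} (A : set R) (s t : R) : R :=
  fine (lebesgue_measure (A `&` `[s, t[)).

Lemma massE {R : realType} (A : set R) (s t : R) : measurable A ->
  (mass A s t)%:E = lebesgue_measure (A `&` `[s, t[).
Proof.
move=> mA; apply: fineK; apply/fin_numPlt; apply/andP; split.
  exact: (@lt_le_trans _ _ 0%E).
apply: (@le_lt_trans _ _ (lebesgue_measure (`[s, t[%classic : set R))).
  by apply: le_measure; rewrite ?inE //; exact: measurableI.
by rewrite lebesgue_measure_itv; case: ifP => _ //=; rewrite -EFinB ltry.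
Qed.

Lemma mass_ge0 {R : realType} (A : set R) (s t : R) : 0 <= mass A s t.
Proof. exact: fine_ge0. Qed.

Lemma massD {R : realType} (A : set R) (r s t : R) : measurable A ->
  s <= r <= t -> mass A s t = mass A s r + mass A r t.
Proof.
move=> mA /andP[sr rt]; apply: EFin_inj; rewrite EFinD !massE //.
have -> : (A `&` `[s, t[) = (A `&` `[s, r[) `|` (A `&` `[r, t[).
  rewrite -setIUr; congr (_ `&` _); apply/seteqP; split => x /=;
    rewrite !in_itv /=.
    by move=> /andP[-> ->]; rewrite andbT; case: (ltP x r) => _; [left|right].
  move=> [/andP[-> xr]|/andP[rx ->]]; first exact: (lt_le_trans xr).
  by rewrite (le_trans sr).
rewrite measureU //; try exact: measurableI.
apply/seteqP; split => x //= [[_ +] [_]]; rewrite !in_itv /=.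
by move=> /andP[_ xr] /andP[/(lt_le_trans xr)]; rewrite ltxx.
Qed.

Lemma mass_affine {R : realType} (A : set R) (r c s t : R) :
  0 < r -> measurable A ->
  lebesgue_measure ((fun x => r * x + c) @^-1` A `&` `[s, t[) =
  (r^-1 * mass A (r * s + c) (r * t + c))%:E.
Proof.
move=> r0 mA; rewrite EFinM massE // -(lebesgue_measure_affine c) //;
  last first.
  exact: measurableI.
congr lebesgue_measure; apply/seteqP; split => x /= [Ax];
  by rewrite !in_itv /= lerD2r ltrD2r ler_pM2l // ltr_pM2l // => ?; split.
Qed.

Lemma mass_le_affine {R : realType} (A : set R) (r c s t : R) :
  0 < r -> measurable A ->
  (forall x, A x -> s <= x < t -> A (r * x + c)) ->
  mass A s t <= r^-1 * mass A (r * s + c) (r * t + c).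
Proof.
move=> r0 mA fwd; rewrite -lee_fin -mass_affine // massE //.
apply: le_measure; rewrite ?inE; first exact: measurableI.
  by apply: measurableI => //; exact: measurable_affine_preimage.
by move=> x [Ax]; rewrite /= in_itv /= => xst; split => //; exact: fwd.
Qed.

Lemma mass_ge_affine {R : realType} (A : set R) (r c s t : R) :
  0 < r -> measurable A ->
  (forall x, s <= x < t -> A (r * x + c) -> A x) ->
  r^-1 * mass A (r * s + c) (r * t + c) <= mass A s t.
Proof.
move=> r0 mA bwd; rewrite -lee_fin -mass_affine // massE //.
apply: le_measure; rewrite ?inE; last first.
- by move=> x [Ax]; rewrite /= in_itv /= => xst; split => //; exact: bwd.
- exact: measurableI.
by apply: measurableI => //; exact: measurable_affine_preimage.
Qed.

(** * The univoque set is null *)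

(** The bookkeeping of masses: the univoque set cannot be spread evenly over the
    [b] pieces of length [1/b], since part of the second piece is ambiguous. *)
Lemma univoque_null (R : realType) (a b : nat) : (1 < a)%N -> (a < b)%N ->
  lebesgue_measure (univoque a b : set R) = 0%E.
Proof.
move=> ha hab.
have a1 : 1 < a%:R :> R by rewrite ltr1n.
have ab : a%:R + 1 <= b%:R :> R by rewrite natr1 ler_nat.
have a0 : 0 < a%:R :> R by lra.
have b0 : 0 < b%:R :> R by lra.
have aN0 : a%:R != 0 :> R by rewrite gt_eqF.
have bN0 : b%:R != 0 :> R by rewrite gt_eqF.
have bV0 : 0 < b%:R^-1 :> R by rewrite invr_gt0.
have an0 : (0 < a)%N by exact: ltnW.
have bn0 : (0 < b)%N by exact: (ltn_trans an0).
have bV1 : b%:R^-1 < 1 :> R by rewrite invf_lt1 //; lra.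
have bVaV : b%:R^-1 < a%:R^-1 :> R by rewrite ltf_pV2 ?posrE //; lra.
pose U : set R := univoque a b.
have mU : measurable U by exact: measurable_univoque.
have U01 x : U x -> 0 <= x < 1.
  by move=> /(_ 0%N I)[]; rewrite in01.
have UnS x : U x -> ~ (b%:R^-1 <= x < a%:R^-1).
  by move=> /(_ 0%N I)[_]; rewrite /ambiguous /= in_itv.
have bdE (d : R) : b%:R * (d / b%:R) = d by rewrite mulrC divfK ?gt_eqF.
pose p := mass U.
have p0 s t : 0 <= p s t by exact: mass_ge0.
have pD s r t : s <= r <= t -> p s t = p s r + p r t by exact: massD.
(* On [[0, 1/b[] the only legal digit is [0], so membership in [U] is
   equivalent at [x] and [a * x] and the scaling is exact. *)
have pa t : 0 <= t <= b%:R^-1 -> p 0 (a%:R * t) = a%:R * p 0 t.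
  move=> /andP[t0 tb].
  have unit x : 0 <= x < t -> 0 <= a%:R * x + 0 < 1.
    move=> /andP[x0 xt]; rewrite addr0 mulr_ge0 ?(ltW a0) //=.
    rewrite -[ltRHS](mulfV aN0) (ltr_pM2l a0); lra.
  have -> : p 0 t = a%:R^-1 * p (a%:R * 0 + 0) (a%:R * t + 0).
    apply/eqP; rewrite eq_le; apply/andP; split.
      apply: mass_le_affine => // x Ux xt.
      have := @univoque_expand R a b 0 x an0 bn0 Ux.
      by rewrite /expand /rate /= oppr0; apply; exact: unit.
    apply: mass_ge_affine => // x xt Ux.
    apply: (@expand_univoque R a b 0 x bn0); last first.
      by rewrite /expand /rate /= oppr0.
    split; first by rewrite in01; move/andP: xt => [x0 xt]; lra.
    by rewrite /ambiguous /= in_itv /=; lra.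
  by rewrite mulr0 !addr0 mulVKf ?gt_eqF.
have pb (d : nat) s t : (0 < d)%N -> d%:R / b%:R <= s -> t <= d.+1%:R / b%:R ->
    p s t <= b%:R^-1 * p (b%:R * s - d%:R) (b%:R * t - d%:R).
  move=> d0 ds td; apply: mass_le_affine => // x Ux /andP[sx xt].
  have := @univoque_expand R a b d x an0 bn0 Ux.
  rewrite /expand /rate gtn_eqF //; apply.
  rewrite subr_ge0 ltrBlDl natr1 -ler_pdivrMl // -ltr_pdivlMl //.
  by rewrite mulrC (le_trans ds) //= mulrC (lt_le_trans xt).
pose v := p 0 1.
have pdig (d : nat) : (0 < d)%N ->
    p (d%:R / b%:R) (d.+1%:R / b%:R) <= b%:R^-1 * v.
  move=> d0; have := pb d _ _ d0 (lexx _) (lexx _).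
  by rewrite !bdE subrr -natr1 addrAC subrr add0r.
pose u := p b%:R^-1 (2 / b%:R).
pose w := p 0 b%:R^-1.
have pdigs (k : nat) : p (2 / b%:R) (k.+2%:R / b%:R) <= k%:R * (b%:R^-1 * v).
  elim: k => [|k IH].
    have := pD (2 / b%:R) (2 / b%:R) (2 / b%:R); rewrite lexx => /(_ isT).
    by rewrite mul0r; lra.
  rewrite (pD _ (k.+2%:R / b%:R)); last first.
    by rewrite !ler_pM2r // !ler_nat /= leqnSn.
  have := pdig k.+2 isT; rewrite -(natr1 k); lra.
have bV2 : b%:R^-1 <= 2 / b%:R :> R by rewrite ler_peMl ?ltW //; lra.
have split0 (k : nat) : (1 < k)%N ->
    p 0 (k%:R / b%:R) = w + u + p (2 / b%:R) (k%:R / b%:R).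
  move=> k1; rewrite (pD 0 (2 / b%:R)); last first.
    by rewrite mulr_ge0 ?(ltW bV0) //= ler_pM2r // ler_nat.
  by rewrite (pD 0 b%:R^-1) // ltW.
have vE : v = w + u + p (2 / b%:R) 1.
  by have := split0 b (ltn_trans ha hab); rewrite divff ?gt_eqF.
have wE : a%:R * w = w + u + p (2 / b%:R) (a%:R / b%:R).
  by rewrite -split0 // pa // lexx ltW.
have y_le : p (2 / b%:R) (a%:R / b%:R) <= (a%:R - 2) * (b%:R^-1 * v).
  have := pdigs a.-2; case: (a) ha => [|[|k]] // _ /=.
  by move=> h; apply: (le_trans h); rewrite -addn2 natrD addrK.
have z_le : p (2 / b%:R) 1 <= (b%:R - 2) * (b%:R^-1 * v).
  have := pdigs b.-2; rewrite -[X in p _ X <= (b%:R - _) * _](divff bN0).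
  case: (b) (ltn_trans ha hab) => [|[|k]] // _ /=.
  by move=> h; apply: (le_trans h); rewrite -addn2 natrD addrK.
(* The two estimates of [w], from the scaling by [a] and from the total mass,
   leave no room: the second piece carries at least its share [v / b]. *)
have v_le : v <= b%:R * u.
  set q := b%:R^-1 * v in y_le z_le.
  have vq : v = b%:R * q by rewrite /q mulVKf ?gt_eqF.
  have h1 : (a%:R - 1) * w <= u + (a%:R - 2) * q by lra.
  have h2 : (a%:R - 1) * v <= (a%:R - 1) * (w + u + (b%:R - 2) * q).
    by rewrite ler_pM2l; lra.
  have h3 : a%:R * q <= a%:R * u by rewrite vq in h2; nra.
  by rewrite vq ler_pM2l //; rewrite ler_pM2l in h3.
(* The digit [1] maps [1/a] to [b/a - 1]; the minimum with [1] covers the case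
   where the whole of [[1/b, 2/b[] is ambiguous. *)
pose t0 := Num.min 1 (b%:R / a%:R - 1) : R.
have ba1 : 1 < b%:R / a%:R :> R by rewrite ltr_pdivlMr //; lra.
have t0_gt0 : 0 < t0 by rewrite lt_min ltr01 subr_gt0.
have t01 : t0 <= 1 by rewrite ge_min lexx.
have u_le : b%:R * u <= p t0 1.
  (* The preimage of [t0] under digit [1]. *)
  pose q := (1 + t0) / b%:R.
  have q1 : b%:R^-1 <= q by rewrite ler_peMl ?ltW //; lra.
  have q2 : q <= 2 / b%:R by rewrite ler_pM2r //; lra.
  have qa : q <= a%:R^-1.
    rewrite ler_pdivrMr // mulrC; have : t0 <= b%:R / a%:R - 1.
      by rewrite ge_min lexx orbT.
    lra.
  have pq0 : p b%:R^-1 q = 0.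
    rewrite /p /mass (_ : _ `&` _ = set0) ?measure0 //.
    apply/seteqP; split => x //= [/UnS nS]; rewrite in_itv /= => /andP[bx xq].
    by apply: nS; rewrite bx (lt_le_trans xq).
  rewrite /u (pD _ q) ?q1 // pq0 add0r -ler_pdivlMl //.
  have := pb 1 q (2 / b%:R) isT; rewrite mul1r => /(_ q1 (lexx _)).
  by rewrite /q !bdE addrAC subrr add0r (_ : 2 - 1%:R = 1) //; lra.
have pt0 : p 0 t0 = 0.
  have : v = p 0 t0 + p t0 1 by apply: pD; rewrite ltW.
  by have := p0 0 t0; lra.
(* A small enough contraction of [[0, 1/b[] by powers of [a] fits in
   [[0, t0[]. *)
have w0 : w = 0.
  have scaled (k : nat) : p 0 (b%:R^-1 / a%:R ^+ k) = w / a%:R ^+ k.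
    elim: k => [|k IH]; first by rewrite expr0 !divr1.
    have ak : 0 < a%:R ^+ k.+1 :> R by rewrite exprn_gt0.
    have := pa (b%:R^-1 / a%:R ^+ k.+1).
    rewrite divr_ge0 ?(ltW ak) ?(ltW bV0) //= ler_pdivrMr //
      ler_peMr ?(ltW bV0) //;
      last by rewrite exprn_ege1 // ltW.
    move=> /(_ isT); rewrite (_ : a%:R * _ = b%:R^-1 / a%:R ^+ k); last first.
      by rewrite exprS; field; rewrite !gt_eqF ?exprn_gt0.
    rewrite IH => wk; apply: (mulfI aN0).
    by rewrite -wk exprS; field; rewrite !gt_eqF ?exprn_gt0.
  have [k kt] : exists k, b%:R^-1 / a%:R ^+ k <= t0.
    have aV : `|a%:R^-1 : R| < 1.
      by rewrite ger0_norm ?invr_ge0 ?ltW // invf_lt1.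
    have [k _ /(_ k (leqnn k)) /= kt] := cvgr_lt _ (cvg_expr aV) _ t0_gt0.
    exists k; rewrite -exprVn; apply: le_trans (ltW kt).
    by rewrite ler_piMl ?(ltW bV1) // exprn_ge0 // invr_ge0 ltW.
  have wk : w / a%:R ^+ k = 0.
    have : p 0 t0 = p 0 (b%:R^-1 / a%:R ^+ k) + p (b%:R^-1 / a%:R ^+ k) t0.
      by apply: pD; rewrite kt divr_ge0 ?exprn_ge0 ?(ltW a0) ?(ltW bV0).
    have := p0 0 (b%:R^-1 / a%:R ^+ k); have := p0 (b%:R^-1 / a%:R ^+ k) t0.
    by rewrite scaled pt0; lra.
  have akN0 : (a%:R ^+ k : R) != 0 by rewrite expf_neq0.
  by rewrite -(divfK akN0 w) wk mul0r.
have v0 : v = 0.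
  have u0 : u = 0.
    have := p0 (2 / b%:R) (a%:R / b%:R); have := p0 b%:R^-1 (2 / b%:R).
    by rewrite -/u; move: wE; rewrite w0 mulr0; lra.
  have := p0 0 1; rewrite -/v; by move: v_le; rewrite u0 mulr0; lra.
rewrite -[LHS]/(lebesgue_measure U).
have -> : U = U `&` `[0, 1[.
  by apply/seteqP; split => x //= => [Ux|[]//]; split => //; rewrite in_itv /= U01.
by rewrite -massE // -/(p 0 1) -/v v0.
Qed.

(** * Points that can reach the univoque set *)

Lemma negligible_affine_preimage {R : realType} (r c : R) (A : set R) :
  0 < r -> (@lebesgue_measure R).-negligible A ->
  (@lebesgue_measure R).-negligible ((fun x => r * x + c) @^-1` A).
Proof.
move=> r0 [B [mB B0 AB]]; exists ((fun x => r * x + c) @^-1` B); split.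
- exact: measurable_affine_preimage.
- by rewrite lebesgue_measure_affine // B0 mule0.
- by move=> x; exact: AB.
Qed.

Fixpoint eventually_univoque {R : realType} (a b n : nat) : set R :=
  if n is n'.+1 then
    \bigcup_d expand a b d @^-1` eventually_univoque a b n'
  else univoque a b.

Lemma eventually_univoque_negligible (R : realType) (a b n : nat) :
  (1 < a)%N -> (a < b)%N ->
  (@lebesgue_measure R).-negligible (eventually_univoque a b n).
Proof.
move=> ha hab; elim: n => [|n IH] /=.
  by apply/negligibleP; [exact: measurable_univoque|exact: univoque_null].
apply: negligible_bigcup => d; apply: (@negligible_affine_preimage _ (rate a b d)%:R (- d%:R) _ _ IH).
have a0 : (0 < a)%N by exact: ltnW.
by rewrite ltr0n /rate; case: ifP => _ //; exact: ltn_trans hab.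
Qed.

(** * Orbits of legal digits are expansions *)

Lemma zerosS (b : nat) (d : nat -> 'I_b) (n : nat) :
  zeros d n.+1 = (zeros d n + (d n == 0%N :> nat))%N.
Proof. by rewrite /zeros big_ord_recr. Qed.

Lemma zeros_le (b : nat) (d : nat -> 'I_b) (n : nat) : (zeros d n <= n)%N.
Proof.
elim: n => [|n IH]; first by rewrite /zeros big_ord0.
by rewrite zerosS -addn1 leq_add // leq_b1.
Qed.

Definition weight {R : realType} (a b : nat) (d : nat -> 'I_b) (n : nat) : R :=
  a%:R^-1 ^+ zeros d n * b%:R^-1 ^+ (n - zeros d n).

(** The partial sum of [n] terms is exactly [x 0 - weight n * x n], and the
    weight is at most [a^-n]. *)
Lemma ab_value_orbit (R : realType) (a b : nat) (d : nat -> 'I_b)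
    (x : nat -> R) : (1 < a)%N -> (a < b)%N ->
  (forall n, 0 <= x n < 1) -> (forall n, x n.+1 = expand a b (d n) (x n)) ->
  ab_value R a d = x 0%N.
Proof.
move=> ha hab x01 xS.
have a1 : 1 < a%:R :> R by rewrite ltr1n.
have ab : a%:R < b%:R :> R by rewrite ltr_nat.
have a0 : 0 < a%:R :> R by lra.
have b0 : 0 < b%:R :> R by lra.
have aV0 : 0 < a%:R^-1 :> R by rewrite invr_gt0.
have bV0 : 0 < b%:R^-1 :> R by rewrite invr_gt0.
have aN0 : a%:R != 0 :> R by rewrite gt_eqF.
have bN0 : b%:R != 0 :> R by rewrite gt_eqF.
pose w n : R := weight a d n.
have w0 n : 0 <= w n by rewrite mulr_ge0 // exprn_ge0 // ltW.
have w_le n : w n <= a%:R^-1 ^+ n.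
  rewrite /w /weight -[in leRHS](subnKC (zeros_le d n)) exprD.
  rewrite ler_pM2l ?exprn_gt0 //.
  by apply: lerXn2r; rewrite ?nnegrE ?ltW // ltf_pV2.
have partial n : series (ab_term R a d) n = x 0%N - w n * x n.
  elim: n => [|n IH].
    by rewrite /series /= big_nil /w /weight /zeros big_ord0 !expr0 !mul1r subrr.
  rewrite seriesSr IH xS /w /weight /ab_term /expand /rate zerosS.
  case: eqP => [->|_].
    by rewrite addn1 subSS mul0r exprS; field.
  by rewrite addn0 subSn ?zeros_le // exprS; field.
apply: cvg_lim => //.
have -> : series (ab_term R a d) = (fun n => x 0%N - w n * x n).
  by apply/funext => n; exact: partial.
rewrite -[X in _ --> X]subr0; apply: cvgB; first exact: cvg_cst.
have aV1 : `|a%:R^-1 : R| < 1 by rewrite ger0_norm ?invf_lt1 ?ltW.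
apply: (@squeeze_cvgr _ _ _ _ (fun=> 0) (fun n => a%:R^-1 ^+ n : R)).
- near=> n; have /andP[xn0 xn1] := x01 n; rewrite mulr_ge0 //=.
  by apply: le_trans (w_le n); rewrite ler_piMr // ltW.
- exact: cvg_cst.
- exact: cvg_expr.
Unshelve. all: by end_near.
Qed.

(** * Coding sequences of bits by expansions *)

(** The bit [c] only matters on the ambiguous interval, where [true] selects
    digit [0] and [false] the positive legal digit. *)
Definition branch_digit {R : realType} (a b : nat) (x : R) (c : bool) : nat :=
  if (x < a%:R^-1) && (c || (x < b%:R^-1)) then 0%N else Num.truncn (b%:R * x).

(** A bit is consumed only when it has been used, that is, on a visit to the
    ambiguous interval; this is what makes the coding injective. *)
Definition branch_step {R : realType} (a b : nat) (xs : R * (nat -> bool)) :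
    R * (nat -> bool) :=
  (expand a b (branch_digit a b xs.1 (xs.2 0%N)) xs.1,
   if b%:R^-1 <= xs.1 < a%:R^-1 then fun n => xs.2 n.+1 else xs.2).

Definition branch_code {R : realType} (a b : nat) (x : R) (s : nat -> bool)
    (n : nat) : nat :=
  let xs := iter n (branch_step a b) (x, s) in branch_digit a b xs.1 (xs.2 0%N).

Lemma branch_digitP (R : realType) (a b : nat) (x : R) (c : bool) :
  (1 < a)%N -> (a < b)%N -> 0 <= x < 1 ->
  (branch_digit a b x c < b)%N /\
  0 <= expand a b (branch_digit a b x c) x < 1.
Proof.
move=> ha hab /andP[x0 x1].
have a0 : 0 < a%:R :> R by rewrite ltr0n ltnW.
have b0 : 0 < b%:R :> R by rewrite ltr0n (ltn_trans _ hab) // ltnW.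
have bVaV : b%:R^-1 < a%:R^-1 :> R by rewrite ltf_pV2 ?posrE // ltr_nat.
rewrite /branch_digit; case: ifPn => [/andP[xa _]|].
  rewrite (ltn_trans _ hab) 1?ltnW //; split => //.
  rewrite /expand /rate /= subr0 mulr_ge0 ?(ltW a0) //=.
  by rewrite -[ltRHS](mulfV (lt0r_neq0 a0)) ltr_pM2l.
rewrite negb_and negb_or -!leNgt => xb.
have {}xb : b%:R^-1 <= x.
  by case/orP: xb => [|/andP[]//]; exact: le_trans (ltW bVaV).
have bx1 : 1 <= b%:R * x by rewrite -[leLHS](mulfV (lt0r_neq0 b0)) ler_pM2l.
have /andP[t1 t2] := truncn_itv (le_trans ler01 bx1).
have t0 : (0 < Num.truncn (b%:R * x))%N.
  by rewrite -ltnS -(ltr_nat R) (le_lt_trans bx1).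
split; last by rewrite /expand /rate gtn_eqF //; move: t2; rewrite -natr1; lra.
rewrite -(ltr_nat R) (le_lt_trans t1) // gtr_pMr //.
Qed.

Lemma iter_branch_step_unit (R : realType) (a b : nat) (x : R) (s : nat -> bool)
    (n : nat) : (1 < a)%N -> (a < b)%N -> 0 <= x < 1 ->
  0 <= (iter n (branch_step a b) (x, s)).1 < 1.
Proof.
move=> ha hab x01; elim: n => [//|n IH].
exact: (proj2 (branch_digitP _ ha hab IH)).
Qed.

(** For [x] in [[0, 1[] the code is always below [b], so that [insubd] never
    falls back on its default ([val_branch_expansion]). *)
Definition branch_expansion {R : realType} (a b : nat) (b0 : (0 < b)%N) (x : R)
    (s : nat -> bool) (n : nat) : 'I_b :=
  insubd (Ordinal b0) (branch_code a b x s n).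

Lemma val_branch_expansion (R : realType) (a b : nat) (b0 : (0 < b)%N) (x : R)
    (s : nat -> bool) (n : nat) : (1 < a)%N -> (a < b)%N -> 0 <= x < 1 ->
  branch_expansion a b0 x s n = branch_code a b x s n :> nat.
Proof.
move=> ha hab x01; rewrite val_insubd.
by case: (branch_digitP ((iter n (branch_step a b) (x, s)).2 0%N) ha hab
  (iter_branch_step_unit s n ha hab x01)) => ->.
Qed.

Lemma branch_expansionP (R : realType) (a b : nat) (b0 : (0 < b)%N) (x : R)
    (s : nat -> bool) : (1 < a)%N -> (a < b)%N -> 0 <= x < 1 ->
  ab_expansions a b x (branch_expansion a b0 x s).
Proof.
move=> ha hab x01; rewrite /ab_expansions /=.
pose orbit n := (iter n (branch_step a b) (x, s)).1.
apply: (@ab_value_orbit _ _ _ _ orbit) => //.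
  by move=> n; exact: iter_branch_step_unit.
by move=> n; rewrite val_branch_expansion.
Qed.

Lemma branch_code0 (R : realType) (a b : nat) (x : R) (s : nat -> bool) :
  branch_code a b x s 0 = branch_digit a b x (s 0%N).
Proof. by []. Qed.

Lemma branch_codeS (R : realType) (a b : nat) (x : R) (s : nat -> bool)
    (n : nat) :
  branch_code a b x s n.+1 =
  branch_code a b (branch_step a b (x, s)).1 (branch_step a b (x, s)).2 n.
Proof. by rewrite /branch_code iterSr; case: (branch_step a b (x, s)). Qed.

Lemma branch_digit_inj (R : realType) (a b : nat) (x : R) : (0 < b)%N ->
  b%:R^-1 <= x < a%:R^-1 -> injective (branch_digit a b x).
Proof.
move=> b0 /andP[bx xa]; have b0' : 0 < b%:R :> R by rewrite ltr0n.
have t0 : (0 < Num.truncn (b%:R * x))%N.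
  by rewrite truncn_gt0 -[leLHS](mulfV (lt0r_neq0 b0')) ler_pM2l.
by case=> -[] //; rewrite /branch_digit xa /= ltNge bx /= => h;
  move: t0; rewrite -?h // h.
Qed.

(** Equal codes follow the same orbit as long as the bits agree.  That orbit
    visits the ambiguous interval, since it starts outside the univoque set; the
    digit chosen there reveals the bit, and the remaining bits are recovered
    from the new point, which satisfies the same hypotheses. *)
Lemma branch_code_inj (R : realType) (a b : nat) (x : R) :
  (1 < a)%N -> (a < b)%N -> 0 <= x < 1 ->
  (forall n, ~ eventually_univoque a b n x) -> injective (branch_code a b x).
Proof.
move=> ha hab x01 xgood s s' ss'; apply/funext => k.
have b0 : (0 < b)%N by rewrite (ltn_trans _ hab) // ltnW.
have exit (y : R) : (forall n, ~ eventually_univoque a b n y) ->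
    exists n, ~ survivors a b n y.
  by move=> yg; apply/existsNP => sy; apply: (yg 0%N) => n _; exact: sy.
have [n nx] := exit x xgood.
(* Outer induction on the index of the bit, inner induction on the time before
   the forced orbit reaches the ambiguous interval. *)
elim/ltn_ind: k n x x01 xgood s s' ss' nx => k IHk.
elim/ltn_ind => n IHn x x01 xgood s s' ss' nx.
have dE : branch_digit a b x (s 0%N) = branch_digit a b x (s' 0%N).
  by rewrite -!branch_code0 ss'.
have [db y01] := branch_digitP (s' 0%N) ha hab x01.
set d := branch_digit a b x (s' 0%N) in dE db y01.
pose y := expand a b d x.
have ygood m : ~ eventually_univoque a b m y.
  by move=> yu; apply: (xgood m.+1); exists d.
have next_eq : branch_code a b y (branch_step a b (x, s)).2 =
               branch_code a b y (branch_step a b (x, s')).2.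
  apply/funext => m; have := congr1 (fun f => f m.+1) ss'.
  by rewrite !branch_codeS /= dE.
have [xamb|/negP xnamb] := boolP (b%:R^-1 <= x < a%:R^-1).
  rewrite /= xamb in next_eq.
  case: k IHk IHn => [|k] IHk _; first exact: (branch_digit_inj b0 xamb).
  have [m my] := exit y ygood.
  exact: (IHk k (ltnSn k) m y y01 ygood _ _ next_eq my).
rewrite /= (negbTE (introN idP xnamb)) in next_eq.
have xua : unambiguous a b x.
  by split; rewrite ?in01 // /ambiguous /= in_itv.
case: n IHn nx => [|n] IHn nx; first by case: nx.
apply: (IHn n (ltnSn n) y y01 ygood _ _ next_eq) => sy.
by apply: nx; split => //; exists d.
Qed.

(** A digit sequence is recovered from its graph, a set of pairs [(i, j)] with
    [j < b], stored at the index [i * b + j]. *)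
Lemma digit_sequences_card_le (b : nat) (A : set (nat -> 'I_b)) :
  (0 < b)%N -> A #<= [set: nat -> bool].
Proof.
move=> b0; apply/pcard_injP.
exists (fun d n => d (n %/ b)%N == (n %% b)%N :> nat) => d e _ _ de.
apply/funext => i; apply/val_inj; apply/eqP.
have := congr1 (fun f => f (i * b + e i)%N) de.
by rewrite /= divnMDl // modnMDl divn_small // modn_small // addn0 eqxx.
Qed.

Unset Implicit Arguments.
Set Strict Implicit.

Theorem theorem3p1 (R : realType) (a b : nat) (ha : (1 < a)%N) (hab : (a < b)%N) :
  {ae (@lebesgue_measure R), forall x : R,
    0 < x < 1 -> ab_expansions a b x #= [set: nat -> bool]}.
Proof.
have b0 : (0 < b)%N by rewrite (ltn_trans _ hab) // ltnW.
have null := negligible_bigcup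
  (fun n => eventually_univoque_negligible R n ha hab).
apply: negligibleS null => x /= xcard; apply: contrapT => xgood; apply: xcard.
move=> /andP[x0 x1]; have x01 : 0 <= x < 1 by rewrite x1 ltW.
apply/card_eqPle; split; first exact: digit_sequences_card_le.
have -> : [set: nat -> bool] = branch_expansion a b0 x @^-1` ab_expansions a b x.
  by apply/esym/seteqP; split => // s _; exact: branch_expansionP.
apply: card_ge_preimage => s s' _ _ ss'.
apply: (branch_code_inj ha hab x01); first by move=> n xn; apply: xgood; exists n.
by apply/funext => n; rewrite -!(val_branch_expansion b0) ?ss'.
Qed.
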